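(* Let $P$ be the poset of join-irreducible elements of a finite distributive lattice, and for $\epsilon=\pm1$ let $C^{(\epsilon)}$ be the polytope associated with the empty sequence (i.e. $t=0$). Then $\dim C^{(1)}=\#P_{\mathrm{nonmax}}$ and $\dim C^{(-1)}=\#P_{\mathrm{nonmin}}$, where $P_{\mathrm{nonmax}}=\{z\in P\mid z\text{ is not in any chain of }P\text{ of maximal length}\}$ and $P_{\mathrm{nonmin}}=\{z\in P\mid z\text{ is not in any maximal chain of }P\text{ of minimal length}\}$.
   Context: $P=\{\alpha\in H: \alpha=\beta\vee\gamma\Rightarrow\alpha=\beta\text{ or }\alpha=\gamma\}$ where $H$ is a finite distributive lattice with least element $x_0$ (so $x_0\in P$ is the least element of $P$). The length of a chain $X$ is $\#X-1$; a maximal chain is one maximal under inclusion, and ''maximal chain of minimal length'' means a maximal chain whose length is least among all maximal chains. Let $P^+=P\cup\{\infty\}$ with $x<\infty$ for all $x\in P$; $x\lessdot y$ means $y$ covers $x$. For $x\le y$ in $P^+$ and $n\in\mathbb Z$, $q^{(n)}\mathrm{dist}(x,y)=\max\{nt\mid\text{there is a saturated chain }x=z_0\lessdot z_1\lessdot\cdots\lessdot z_t=y\}$. For the empty sequence, $C^{(\epsilon)}$ is the convex polytope of all $\nu:P^+\to\mathbb R$ with $\nu(\infty)=0$, $\nu(z)-\nu(z')\ge\epsilon$ whenever $z\lessdot z'$ in $P^+$, and $\nu(x_0)-\nu(\infty)=q^{(\epsilon)}\mathrm{dist}(x_0,\infty)$; it is regarded as a subset of $\mathbb R^P$. *)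

(* Defs.v *)
From HB Require Import structures.
From mathcomp Require Import all_boot all_order all_algebra.
From mathcomp Require Import boolp classical_sets reals.

Set Implicit Arguments.
Unset Strict Implicit.
Unset Printing Implicit Defensive.

Import Order.TTheory GRing.Theory Num.Theory.

Local Open Scope order_scope.

Section Posets.
Context {disp : Order.disp_t} {T : finPOrderType disp}.
Implicit Types (x y : T) (X Y : {set T}).

(* [covers x y] reads "y covers x". *)
Definition covers x y : bool := (x < y) && ~~ [exists w, x < w < y].

Definition is_chain X : bool := [forall x in X, forall y in X, x >=< y].

(* An integer, so that the empty chain has length -1. *)
Definition chain_length X : int := (#|X|%:Z - 1)%R.

Definition longest_chain X : bool :=
  is_chain X && [forall (Y : {set T} | is_chain Y),
                   (chain_length Y <= chain_length X)%R].

Definition maximal_chain X : bool := maxset is_chain X.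

Definition shortest_maximal_chain X : bool :=
  maximal_chain X && [forall (Y : {set T} | maximal_chain Y),
                        (chain_length X <= chain_length Y)%R].

Definition Pnonmax : {set T} :=
  [set z | ~~ [exists X : {set T}, longest_chain X && (z \in X)]].

Definition Pnonmin : {set T} :=
  [set z | ~~ [exists X : {set T}, shortest_maximal_chain X && (z \in X)]].

Definition saturated_chain x y (t : nat) : bool :=
  [exists p : t.-tuple T, path covers x p && (last x p == y)].

(* [qdist n x y] is the maximum of n * t over the lengths t of saturated
   chains from x to y. Such lengths are at most #|T|, and the default ord0 is
   only relevant when there is no such chain, i.e. when x <= y fails; see
   [qdistP]. *)
Definition qdist (n : int) x y : int :=
  let len (t : 'I_#|T|.+1) : int := (n * (t : nat)%:Z)%R in
  len [arg max_(t > ord0 | saturated_chain x y t) len t].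

Lemma saturated_chain_exists x y : x <= y -> exists t, saturated_chain x y t.
Proof.
have [n] := ubnP #|[set w | x < w <= y]|.
elim: n x => // n IHn x ltn; rewrite le_eqVlt => /orP[/eqP <-|ltxy].
  by exists 0; apply/existsP; exists [tuple] => /=.
pose f w := #|[set v | x < v <= w]|.
have xyy : x < y <= y by rewrite ltxy lexx.
have [w /andP[xw wy] wmin] := @arg_minnP _ y (fun w => x < w <= y) f xyy.
have cxw : covers x w.
  rewrite /covers xw /=; apply/existsP => -[v /andP[xv vw]].
  have := wmin v; rewrite xv (ltW (lt_le_trans vw wy)) => /(_ isT).
  apply/negP; rewrite -ltnNge; apply: proper_card; apply/properP; split.
    apply/fintype.subsetP => u; rewrite !inE => /andP[-> uv] /=.
    exact: le_trans uv (ltW vw).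
  by exists w; rewrite !inE xw ?lexx //= lt_geF.
have ltwn : (#|[set v | (w < v <= y)%O]| < n)%N.
  rewrite -ltnS; apply: leq_trans ltn; rewrite ltnS; apply: proper_card.
  apply/properP; split.
    by apply/fintype.subsetP => u; rewrite !inE => /andP[/(lt_trans xw) -> ->].
  by exists w; rewrite !inE ?xw ?ltxx ?wy.
have [t /existsP[p /andP[pp lp]]] := IHn w ltwn wy.
by exists t.+1; apply/existsP; exists [tuple of w :: p]; rewrite /= cxw pp.
Qed.

Lemma saturated_chain_bound x y t : saturated_chain x y t -> (t < #|T|)%N.
Proof.
move=> /existsP[p /andP[pp _]].
have ltp : path <%O x p by apply: sub_path pp => u v /= /andP[].
have := sorted_uniq lt_trans ltxx (ltp : sorted <%O (x :: p)).
by move/card_uniqP => /= cp; have := max_card (mem (x :: p)); rewrite cp size_tuple.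
Qed.

Lemma qdistP n x y : x <= y ->
  (exists2 t : nat, saturated_chain x y t & qdist n x y = (n * t%:Z)%R) /\
  (forall t : nat, saturated_chain x y t -> (n * t%:Z <= qdist n x y)%R).
Proof.
move=> /saturated_chain_exists[t0 st0].
have b t : saturated_chain x y t -> (t < #|T|.+1)%N.
  by move/saturated_chain_bound/ltnW.
rewrite /qdist /Order.arg_max /extremum.
case: pickP => [i /andP[si /forallP mi]|none] /=.
  split=> [|t st]; first by exists i.
  by have /implyP/(_ st) := mi (Ordinal (b _ st)).
have [j sj mj] := @Order.TotalTheory.arg_maxP _ _ _ (Ordinal (b _ st0))
  (fun t : 'I_#|T|.+1 => saturated_chain x y t)
  (fun t => (n * (t : nat)%:Z)%R) st0.
have /negP[] := negbT (none j).
by rewrite /= sj; apply/forallP => k; apply/implyP => /mj.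
Qed.

End Posets.

Arguments Pnonmax {disp} T.
Arguments Pnonmin {disp} T.

(* The poset T with a new greatest element None. *)
Definition with_infty (T : Type) : Type := option T.

Section WithInfty.
Context {disp : Order.disp_t} {T : finPOrderType disp}.

HB.instance Definition _ := Finite.on (with_infty T).

Definition le_infty (x y : with_infty T) : bool :=
  match x, y with
  | _, None => true
  | None, Some _ => false
  | Some a, Some b => a <= b
  end.

Fact le_infty_refl : reflexive le_infty.
Proof. by case=> //= a. Qed.

Fact le_infty_anti : antisymmetric le_infty.
Proof. by case=> [a|] [b|] //= /le_anti ->. Qed.

Fact le_infty_trans : transitive le_infty.
Proof. by case=> [b|] [a|] [c|] //=; apply: le_trans. Qed.

HB.instance Definition _ := Order.Le_isPOrder.Build disp (with_infty T)
  le_infty_refl le_infty_anti le_infty_trans.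

Definition fin (x : T) : with_infty T := Some x.
Definition infty : with_infty T := None.

End WithInfty.

Section JoinIrreducible.
Context {disp : Order.disp_t} (H : finTBDistrLatticeType disp).

(* The least element of H counts as join-irreducible. *)
Definition join_irreducible (a : H) : bool :=
  [forall b : H, forall c : H, (a == b `|` c) ==> (a == b) || (a == c)].

Definition join_irreducibles : Type := {a : H | join_irreducible a}.

HB.instance Definition _ := SubFinite.on join_irreducibles.
HB.instance Definition _ :=
  [SubChoice_isSubPOrder of join_irreducibles by <: with disp].

Fact join_irreducible0 : join_irreducible \bot.
Proof.
apply/forallP => b; apply/forallP => c; apply/implyP.
by rewrite eq_sym join_eq0 => /andP[/eqP-> _]; rewrite eqxx.
Qed.

Definition x0 : join_irreducibles := exist _ \bot join_irreducible0.

End JoinIrreducible.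

Local Open Scope classical_set_scope.
Local Open Scope ring_scope.

Section Polytope.
Context (R : realType) {disp : Order.disp_t} (H : finTBDistrLatticeType disp).
Local Notation P := (join_irreducibles H).
Local Notation Pplus := (with_infty P).

Definition in_polytope (eps : int) (nu : Pplus -> R) : Prop :=
  [/\ nu infty = 0,
      forall z z' : Pplus, covers z z' -> eps%:~R <= nu z - nu z'
    & nu (fin (x0 H)) - nu infty = (qdist eps (fin (x0 H)) infty)%:~R].

(* Restriction to P is injective on this set, since nu infty = 0. *)
Definition polytope (eps : int) : set {ffun P -> R^o} :=
  [set [ffun z => nu (fin z)] | nu in in_polytope eps].

End Polytope.

Arguments polytope R {disp} H eps.

Section AffineDimension.
Context {R : fieldType} {V : vectType R}.
Implicit Types (C : set V) (U : {vspace V}).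

Definition affine_hull C : set V :=
  [set v | exists (n : nat) (x : 'I_n -> V) (a : 'I_n -> R),
     [/\ forall i, C (x i), \sum_i a i = 1 & v = \sum_i a i *: x i]].

(* The affine hull of C is a translate of a d-dimensional linear subspace.
   In particular C is nonempty. *)
Definition has_dim C (d : nat) : Prop :=
  exists (v : V) (U : {vspace V}),
    affine_hull C = [set v + u | u in [set u | u \in U]] /\ \dim U = d.

Lemma has_dim_unique C d d' : has_dim C d -> has_dim C d' -> d = d'.
Proof.
move=> [v [U [hU <-]]] [v' [U' [hU' <-]]].
suff sub w w' (W W' : {vspace V}) :
    [set w + u | u in [set u | u \in W]] = [set w' + u | u in [set u | u \in W']] ->
    (W <= W')%VS.
  by congr (\dim _); apply/eqP; rewrite eqEsubv (sub v v') ?(sub v' v) // -hU -hU'.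
move=> e; apply/subvP => u uW.
have : [set w + u | u in [set u | u \in W]] (w + u) by exists u.
have : [set w + u | u in [set u | u \in W]] w by exists 0; rewrite ?addr0 //= mem0v.
rewrite e => -[u1 /= h1 e1] [u2 /= h2 e2].
have -> : u = u2 - u1.
  by apply: (addrI w); rewrite -e2 -e1 addrACA subrr addr0.
exact: rpredB.
Qed.

End AffineDimension.

(* Main.v *)
Require Import Defs.
From mathcomp Require Import all_boot all_order all_algebra.
From mathcomp Require Import reals.
From mathcomp Require classical_sets.
From mathcomp Require Import zify.

(**
Both equalities are instances of one statement, valid for every integer n in
place of 1 and -1. Write q for the n-weighted distance in P+, b for the least
element and M = q(b, oo). Call z critical when q(b, z) + q(z, oo) = M, that is,
when z lies on a saturated chain from b to oo whose weight is the maximum M.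
Then the polytope has dimension the number of noncritical elements of P
([has_dim_polytope]).

Upper bound. Adding up the inequalities along saturated chains gives
q(x, y) <= nu(x) - nu(y) for every point nu of the polytope. The two bounds
q(b, z) <= M - nu(z) and q(z, oo) <= nu(z) coincide when z is critical, so nu(z)
is then determined ([polytope_critical]).

Lower bound. The function f(z) = q(z, oo) is a point of the polytope, the least
one. For a noncritical c there is room to raise f by 1 at c: set
h_c(z) = max(f(z), q(z, c) + f(c) + 1) for z <= c and h_c = f elsewhere. This
respects every covering inequality, and it keeps the value M at b because
distances are integers, so that q(b, c) + q(c, oo) <= M - 1. Each difference
h_c - f vanishes at critical elements and outside the elements below c, and is
1 at c: these vectors are triangular for the order of P, hence linearly
independent, and f together with the h_c affinely spans the space of functions
that agree with f at the critical elements.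

It remains to recognize the critical elements. Adjoining oo to a maximal chain
X of P gives the set of vertices of a saturated chain from b to oo of length
#|X|, and every saturated chain from b to oo arises in this way
([maximal_chain_saturated], [saturated_maximal_chain]). So z is critical exactly
when it belongs to a maximal chain that maximizes n * #|X| ([criticalP]): for
n = 1 these are the longest chains, and for n = -1 the shortest maximal chains.
*)

Set Implicit Arguments.
Unset Strict Implicit.
Unset Printing Implicit Defensive.

Import Order.TTheory GRing.Theory Num.Theory.

Local Open Scope ring_scope.

(** * Saturated chains *)

Section SaturatedChains.
Context {disp : Order.disp_t} {T : finPOrderType disp}.
Implicit Types (x y z w : T) (S X Y : {set T}).
Local Open Scope order_scope.

Lemma saturated_chainP x y t :
  reflect (exists p, [/\ path covers x p, last x p = y & size p = t])
          (saturated_chain x y t).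
Proof.
apply: (iffP existsP) => [[p /andP[xp /eqP yp]]|[p [xp yp /eqP sp]]].
  by exists p; rewrite size_tuple.
by exists (Tuple sp); rewrite xp /= yp eqxx.
Qed.

Lemma covers_lt x y : covers x y -> x < y.
Proof. by case/andP. Qed.

Lemma covers_between x y z : covers x z -> x <= y <= z -> y = x \/ y = z.
Proof.
move=> /andP[_ /existsPn/(_ y)]; rewrite !lt_neqAle => h /andP[xy yz].
move: h; rewrite xy yz !andbT negb_and !negbK eq_sym.
by move=> /orP[] /eqP; [left | right].
Qed.

Lemma path_covers_lt x p : path covers x p -> path <%O x p.
Proof. by apply: sub_path => u v; apply: covers_lt. Qed.

Lemma path_covers_uniq x p : path covers x p -> uniq (x :: p).
Proof.
move=> /path_covers_lt xp.
exact: (sorted_uniq lt_trans ltxx (xp : sorted <%O (x :: p))).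
Qed.

Lemma path_covers_comparable x p :
  path covers x p -> {in x :: p &, forall y z, y >=< z}.
Proof.
elim: p x => [|w p IHp] x /=.
  by move=> _ y z; rewrite !inE => /eqP-> /eqP->; rewrite comparablexx.
move=> /andP[xw wp].
have xlt : {in w :: p, forall y, x <= y}.
  have : path <%O x (w :: p) by rewrite /= covers_lt ?path_covers_lt.
  by rewrite (path_sortedE lt_trans) => /andP[/allP h _] y /h /ltW.
move=> y z; rewrite in_cons [z \in _]in_cons.
move=> /orP[/eqP->|yp] /orP[/eqP->|zp]; rewrite ?comparablexx //.
- exact: le_comparable (xlt _ zp).
- exact: ge_comparable (xlt _ yp).
- exact: (IHp w wp).
Qed.

Lemma saturated_chain_le x y t : saturated_chain x y t -> x <= y.
Proof.
case/saturated_chainP=> p [/path_covers_lt xp <- _].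
elim: p x xp => //= w p IHp x /andP[xw /IHp]; exact/le_trans/ltW.
Qed.

Lemma saturated_chain0 x : saturated_chain x x 0.
Proof. by apply/saturated_chainP; exists [::]. Qed.

Lemma saturated_chain1 x y : covers x y -> saturated_chain x y 1.
Proof. by move=> xy; apply/saturated_chainP; exists [:: y]; rewrite /= xy. Qed.

Lemma saturated_chain_cat x y z s t :
  saturated_chain x y s -> saturated_chain y z t -> saturated_chain x z (s + t).
Proof.
move=> /saturated_chainP[p [xp yp sp]] /saturated_chainP[r [yr zr sr]].
apply/saturated_chainP; exists (p ++ r).
by rewrite cat_path last_cat size_cat xp yp sp sr.
Qed.

(** A saturated chain cannot be refined: on it, an element y comparable with
    all vertices either falls between two consecutive vertices, hence equals
    one of them, or lies above all vertices but possibly the last. *)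
Lemma mem_saturated_path x p y :
  path covers x p -> x <= y <= last x p -> {in x :: p, forall z, y >=< z} ->
  y \in x :: p.
Proof.
elim: p x => [|w p IHp] x /=; first by move=> _ /le_anti->; rewrite mem_head.
move=> /andP[xw wp] /andP[xy yl] cmp.
have /orP[yw|wy] : y >=< w by apply: cmp; rewrite !inE eqxx orbT.
  have [] : y = x \/ y = w by apply: covers_between xw _; rewrite xy.
    by move->; rewrite mem_head.
  by move->; rewrite !inE eqxx orbT.
rewrite inE IHp ?orbT ?wy // => z zp.
by apply: cmp; rewrite inE zp orbT.
Qed.

(** The next vertex after x is a smallest element w of S strictly above x.
    Nothing lies strictly between x and w: such an element would be comparable
    with all of S, hence in S, against the choice of w. *)
Lemma saturated_chain_in S x y :
  is_chain S -> (forall w, {in S, forall u, w >=< u} -> w \in S) ->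
  x \in S -> y \in S -> x <= y ->
  saturated_chain x y #|[set w in S | x < w <= y]|.
Proof.
move=> chS maxS; have {}chS : {in S &, forall u v, u >=< v}.
  by move=> u v uS vS; have /forall_inP/(_ u uS)/forall_inP/(_ v vS) := chS.
have [n] := ubnP #|[set w in S | x < w <= y]|.
elim: n x => // n IHn x ltn xS yS; rewrite le_eqVlt => /orP[/eqP<-|xy].
  have -> : [set w in S | x < w <= x] = finset.set0.
    by apply/setP => w; rewrite !inE lt_le_asym andbF.
  by rewrite cards0 saturated_chain0.
pose I := [pred w | [&& w \in S, x < w & w <= y]].
have Iy : I y by rewrite /= yS xy lexx.
(* Minimizing the number of elements of S below w yields a minimal w, which in
   a chain is a least one. *)
have [w /and3P[wS xw wy] wmin] :=
  @arg_minnP _ y I (fun w => #|[set v in S | v <= w]|) Iy.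
have {}wmin u : u \in S -> x < u -> w <= u.
  move=> uS xu; have /orP[//|uw] := chS w u wS uS.
  move: uw; rewrite le_eqVlt => /orP[/eqP->//|uw].
  have := wmin u; rewrite /= uS xu (le_trans (ltW uw) wy) => /(_ isT).
  rewrite leqNgt => /negP[]; apply/proper_card/properP; split.
    by apply/fintype.subsetP => v; rewrite !inE => /andP[-> /le_trans-> //]; apply: ltW.
  by exists w; rewrite !inE wS ?lexx //= lt_geF.
have cxw : covers x w.
  rewrite /covers xw; apply/existsPn => v; apply/negP => /andP[xv vw].
  suff /wmin/(_ xv) : v \in S by rewrite lt_geF.
  apply: maxS => u uS; have /orP[ux|xu] := chS _ _ uS xS.
    by apply: ge_comparable; apply: le_trans ux (ltW xv).
  move: xu; rewrite le_eqVlt => /orP[/eqP<-|/(wmin _ uS) wu].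
    exact/ge_comparable/ltW.
  by apply: le_comparable; apply: le_trans (ltW vw) wu.
have split_x : [set v in S | x < v <= y] = w |: [set v in S | w < v <= y].
  apply/setP => v; rewrite !inE; case: eqVneq => [->|vw]; first by rewrite wS xw wy.
  case vS: (v \in S) => //=; case vy: (v <= y); rewrite ?andbF // !andbT.
  apply/idP/idP => [/(wmin _ vS)|/(lt_trans xw)//].
  by rewrite lt_neqAle eq_sym vw.
have w_notin : w \notin [set v in S | w < v <= y] by rewrite !inE ltxx andbF.
rewrite split_x cardsU1 w_notin in ltn *.
exact: saturated_chain_cat (saturated_chain1 cxw) (IHn _ ltn wS yS wy).
Qed.

End SaturatedChains.

(** * The weighted distance *)

Section QDist.
Context {disp : Order.disp_t} {T : finPOrderType disp}.
Implicit Types (x y z : T) (n : int).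

Lemma qdist_ge n x y t : saturated_chain x y t -> n * t%:Z <= qdist n x y.
Proof. by move=> s; have [_] := qdistP n (saturated_chain_le s); apply. Qed.

Lemma qdist_covers n x y : covers x y -> n <= qdist n x y.
Proof. by move=> /saturated_chain1/(qdist_ge n); rewrite mulr1. Qed.

Lemma qdistxx n x : qdist n x x = 0.
Proof.
have [[t /saturated_chainP[p [xp lp <-]] ->] _] := qdistP n (lexx x).
case/lastP: p xp lp => [|p y]; first by rewrite mulr0.
rewrite last_rcons => /path_covers_uniq /=.
by move=> + yx; rewrite yx mem_rcons mem_head.
Qed.

Lemma qdist_triangle n x y z : (x <= y)%O -> (y <= z)%O ->
  qdist n x y + qdist n y z <= qdist n x z.
Proof.
move=> /(qdistP n)[[s xy ->] _] /(qdistP n)[[t yz ->] _].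
by rewrite -mulrDr -PoszD; apply/qdist_ge/saturated_chain_cat/yz.
Qed.

(** The inequalities along a saturated chain telescope. *)
Lemma qdist_potential (R : numDomainType) n (nu : T -> R) :
  (forall x y, covers x y -> n%:~R <= nu x - nu y) ->
  forall x y, (x <= y)%O -> (qdist n x y)%:~R <= nu x - nu y.
Proof.
move=> hnu x y /(qdistP n)[[t /saturated_chainP[p [xp <- <-]] ->] _] {y t}.
elim: p x xp => [|w p IHp] x /=; first by rewrite mulr0 subrr.
move=> /andP[/hnu xw /IHp wp].
by rewrite -(subrKA (nu w)) intS mulrDr mulr1 rmorphD lerD.
Qed.

End QDist.

(** * Maximal chains and critical elements *)

Section Infinity.
Context {disp : Order.disp_t} {P : finPOrderType disp}.
Implicit Types (X Y : {set P}) (z : P).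
Local Notation Pplus := (with_infty P).
Local Notation oo := (infty : Pplus).

Lemma le_fin (a b : P) : (fin a <= fin b :> Pplus)%O = (a <= b)%O.
Proof. by []. Qed.

Lemma le_inftyx (z : Pplus) : (z <= oo)%O.
Proof. by case: z. Qed.

Variable b : P.
Hypothesis le_b : forall z, (b <= z)%O.

Lemma le_fin_bottom (z : Pplus) : (fin b <= z)%O.
Proof. by case: z => // z; apply: le_b. Qed.

Definition add_infty X : {set Pplus} := oo |: [set fin a | a in X]%SET.

Lemma mem_add_infty X z : (fin z \in add_infty X) = (z \in X).
Proof. by rewrite !inE /= mem_imset // => u v []. Qed.

Lemma card_add_infty X : #|add_infty X| = #|X|.+1.
Proof.
rewrite cardsU1 card_imset; last by move=> u v [].
by rewrite (_ : oo \notin _) //; apply/imsetP => -[].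
Qed.

Lemma maximal_chainP X :
  maximal_chain X <->
  is_chain X /\ (forall z, {in X, forall u, z >=< u}%O -> z \in X).
Proof.
split=> [/maxsetP[chX maxX]|[chX maxX]].
  split=> // z zX; have <- : z |: X = X.
    apply: maxX; last exact: subsetU1.
    apply/forall_inP => u; rewrite !inE => /orP[/eqP->|uX].
      apply/forall_inP => v; rewrite !inE => /orP[/eqP->|/zX//].
      exact: comparablexx.
    apply/forall_inP => v; rewrite !inE => /orP[/eqP->|vX].
      by rewrite comparable_sym zX.
    by move/forall_inP/(_ u uX)/forall_inP: chX; apply.
  by rewrite !inE eqxx.
apply/maxsetP; split=> // Y chY XY; apply/eqP; rewrite eqEsubset XY andbT.
apply/fintype.subsetP => z zY; apply: maxX => u /(fintype.subsetP XY).
by move/forall_inP/(_ z zY)/forall_inP: chY; apply.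
Qed.

(** X together with oo is a maximal chain of P+, so it is traversed by
    saturated chains. The length of the one from b to oo counts all its
    elements except b: this is #|X|, since oo is counted and b is not. *)
Lemma maximal_chain_saturated X z : maximal_chain X -> z \in X ->
  exists s t, [/\ saturated_chain (fin b : Pplus) (fin z) s,
                  saturated_chain (fin z : Pplus) oo t & (s + t)%N = #|X|].
Proof.
move=> /maximal_chainP[chX maxX] zX.
have bX : b \in X by apply: maxX => u _; apply: le_comparable.
have chS : is_chain (add_infty X).
  apply/forall_inP => -[u|] uX; apply/forall_inP => -[v|] vX.
  - rewrite -/(fin u) -/(fin v) !mem_add_infty in uX vX.
    by move/forall_inP/(_ u uX)/forall_inP: chX; apply.
  - exact/le_comparable/le_inftyx.
  - exact/ge_comparable/le_inftyx.
  - exact: comparablexx.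
have maxS (w : Pplus) : {in add_infty X, forall u, w >=< u}%O -> w \in add_infty X.
  case: w => [w|] wX; last by rewrite !inE.
  rewrite -/(fin w) mem_add_infty; apply: maxX => u uX.
  by apply: (wX (fin u)); rewrite mem_add_infty.
have ooS : oo \in add_infty X by rewrite !inE.
have zS : fin z \in add_infty X by rewrite mem_add_infty.
have bS : fin b \in add_infty X by rewrite mem_add_infty.
have s1 := saturated_chain_in chS maxS bS zS (le_fin_bottom _).
have s2 := saturated_chain_in chS maxS zS ooS (le_inftyx _).
eexists; eexists; split; [exact: s1 | exact: s2 |].
apply: succn_inj; rewrite -card_add_infty.
set A := [set w in _ | _]; set B := [set w in _ | _].
(* A and B are the vertices after b up to z, and those after z. *)
have -> : add_infty X = fin b |: (A :|: B).
  apply/setP => w; rewrite [RHS]in_setU1 [w \in A :|: B]in_setU [w \in A]inE [w \in B]inE.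
  rewrite le_inftyx.
  have [->|wb] := eqVneq w (fin b); first by rewrite bS.
  case wS: (w \in add_infty X) => //=.
  have bw : (fin b < w)%O by rewrite lt_neqAle eq_sym wb le_fin_bottom.
  have /forall_inP/(_ w wS)/forall_inP/(_ (fin z) zS) := chS.
  by move=> wz; rewrite bw andbT comparable_leNgt //= orNb.
have bAB : fin b \notin A :|: B.
  by rewrite !inE ltxx (le_gtF (le_fin_bottom _)) /= !andbF.
rewrite cardsU1 bAB add1n.
rewrite -cardsUI; suff -> : A :&: B = finset.set0 by rewrite cards0 addn0.
apply/setP => w; rewrite !inE; case wz: (w <= fin z)%O; rewrite ?andbF //.
by rewrite (le_gtF wz) !andbF.
Qed.

(** The vertices other than oo form the chain. An element comparable with all
    of them lies between b and oo, hence is itself a vertex by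
    [mem_saturated_path]. *)
Lemma saturated_maximal_chain z s t :
  saturated_chain (fin b : Pplus) (fin z) s -> saturated_chain (fin z : Pplus) oo t ->
  exists X : {set P}, [/\ maximal_chain X, z \in X & #|X| = (s + t)%N].
Proof.
move=> /saturated_chainP[p [bp lp <-]] /saturated_chainP[r [zr lr <-]].
have bpr : path covers (fin b : Pplus) (p ++ r) by rewrite cat_path bp lp.
have lpr : last (fin b : Pplus) (p ++ r) = oo by rewrite last_cat lp.
pose q := fin b :: p ++ r.
have zq : fin z \in q by rewrite /q -cat_cons mem_cat -lp mem_last.
pose X := [set a : P | fin a \in q]%SET.
have cmpq := path_covers_comparable bpr.
exists X; split; last 1 first.
- have XE : add_infty X = [set w in q].
    apply/setP => -[a|]; first by rewrite -/(fin a) mem_add_infty !inE.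
    by rewrite [RHS]inE /q -[X in X \in _ :: _]lpr mem_last !inE.
  apply: succn_inj; rewrite -card_add_infty XE cardsE.
  by rewrite (card_uniqP (path_covers_uniq bpr)) /= size_cat.
- apply/maximal_chainP; split.
    apply/forall_inP => u; rewrite inE => uq; apply/forall_inP => v; rewrite inE => vq.
    exact: (cmpq _ _ uq vq).
  move=> a aX; rewrite inE; apply: mem_saturated_path => //.
    by rewrite lpr le_fin_bottom le_inftyx.
  move=> [u|] uq; first by apply: (aX u); rewrite inE.
  exact/le_comparable/le_inftyx.
- by rewrite inE.
Qed.

Definition critical (n : int) z : bool :=
  qdist n (fin b : Pplus) (fin z) + qdist n (fin z : Pplus) oo
  == qdist n (fin b : Pplus) oo.

Lemma maximal_chain_qdist n X :
  maximal_chain X -> n * #|X|%:Z <= qdist n (fin b : Pplus) oo.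
Proof.
move=> mX; have /maximal_chainP[_ maxX] := mX.
have bX : b \in X by apply: maxX => u _; apply: le_comparable.
have [s [t [bs st <-]]] := maximal_chain_saturated mX bX.
exact/qdist_ge/saturated_chain_cat/st.
Qed.

Lemma qdist_maximal_chain n :
  exists2 X : {set P}, maximal_chain X & qdist n (fin b : Pplus) oo = n * #|X|%:Z.
Proof.
have [[t bt ->] _] := qdistP n (le_inftyx (fin b)).
have [X [mX _ cX]] := saturated_maximal_chain (saturated_chain0 _) bt.
by exists X => //; rewrite cX.
Qed.

(** Distances from b to z and from z to oo are attained by saturated chains,
    whose concatenation is a maximal chain through z. Conversely, a maximal
    chain X splits at z into saturated chains, so n * #|X| is at most
    q(b, z) + q(z, oo), which is in turn at most the maximum q(b, oo). *)
Lemma criticalP n z :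
  critical n z <->
  exists X : {set P}, [/\ maximal_chain X, z \in X &
    forall Y : {set P}, maximal_chain Y -> n * #|Y|%:Z <= n * #|X|%:Z].
Proof.
split=> [/eqP crit|[X [mX zX optX]]].
  have [[s bs qs] _] := qdistP n (le_fin_bottom (fin z)).
  have [[t zt qt] _] := qdistP n (le_inftyx (fin z)).
  have [X [mX zX cX]] := saturated_maximal_chain bs zt.
  exists X; split=> // Y mY.
  by rewrite cX PoszD mulrDr -qs -qt crit maximal_chain_qdist.
have [s [t [bs zt cX]]] := maximal_chain_saturated mX zX.
rewrite /critical eq_le qdist_triangle ?le_fin_bottom ?le_inftyx //=.
have [Y mY ->] := qdist_maximal_chain n.
apply: le_trans (optX _ mY) _; rewrite -cX PoszD mulrDr.
by apply: lerD; apply: qdist_ge.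
Qed.

(** A chain of maximal cardinality is maximal under inclusion, and every chain
    extends to a maximal one; so competing against maximal chains is enough. *)
Lemma longest_chainE X :
  longest_chain X <->
  maximal_chain X /\ forall Y, maximal_chain Y -> 1 * #|Y|%:Z <= 1 * #|X|%:Z.
Proof.
rewrite /longest_chain /chain_length.
split=> [/andP[chX /forall_inP optX]|[mX optX]].
  have {}optX Y : is_chain Y -> #|Y|%:Z <= #|X|%:Z.
    by move=> /optX; rewrite lerD2r.
  split; last by move=> Y /maxsetp; rewrite !mul1r; apply: optX.
  apply/maxsetP; split=> // Y /optX cY XY; apply/eqP.
  by rewrite eq_sym eqEcard XY.
rewrite (maxsetp mX); apply/forall_inP => Y chY.
have [Z mZ YZ] := maxset_exists chY.
rewrite lerD2r; apply: le_trans (_ : #|Z|%:Z <= _); first exact: subset_leq_card.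
by move: (optX Z mZ); rewrite !mul1r.
Qed.

Lemma shortest_maximal_chainE X :
  shortest_maximal_chain X <->
  maximal_chain X /\ forall Y, maximal_chain Y -> -1 * #|Y|%:Z <= -1 * #|X|%:Z.
Proof.
rewrite /shortest_maximal_chain /chain_length.
split=> [/andP[mX /forall_inP optX]|[mX optX]].
  by split=> // Y /optX; rewrite lerD2r !mulN1r lerN2.
by rewrite mX; apply/forall_inP => Y /optX; rewrite lerD2r !mulN1r lerN2.
Qed.

Lemma in_Pnonmax z : (z \in Pnonmax P) = ~~ critical 1 z.
Proof.
rewrite inE; congr (~~ _); apply/existsP/idP.
  move=> [X /andP[/longest_chainE[mX optX] zX]].
  by apply/criticalP; exists X.
move=> /criticalP[X [mX zX optX]]; exists X; rewrite zX andbT.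
exact/longest_chainE.
Qed.

Lemma in_Pnonmin z : (z \in Pnonmin P) = ~~ critical (-1) z.
Proof.
rewrite inE; congr (~~ _); apply/existsP/idP.
  move=> [X /andP[/shortest_maximal_chainE[mX optX] zX]].
  by apply/criticalP; exists X.
move=> /criticalP[X [mX zX optX]]; exists X; rewrite zX andbT.
exact/shortest_maximal_chainE.
Qed.

End Infinity.

(** * Computing an affine dimension *)

Section LinearAlgebra.
Import classical_sets.
Local Open Scope classical_set_scope.

(** The points v and v + u for u in s are affinely independent. A vector v + w
    with w = sum of c_j *: s_j is their affine combination with coefficient
    c_j at v + s_j and 1 - sum of c_j at v. *)
Lemma has_dim_free (R : fieldType) (V : vectType R) (C : set V) (v : V) (s : seq V) :
  C v -> (forall u, u \in s -> C (v + u)) ->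
  (forall w, C w -> w - v \in <<s>>%VS) -> free s -> has_dim C (size s).
Proof.
move=> Cv Cs sC /eqP dim_s; exists v, <<s>>%VS; split=> //.
apply/seteqP; split=> w /=.
  move=> [n [x [a [Cx a1 ->]]]]; exists (\sum_i a i *: (x i - v)).
    by apply: rpred_sum => i _; apply/rpredZ/sC.
  under eq_bigr do rewrite scalerBr.
  by rewrite sumrB -scaler_suml a1 scale1r addrC subrK.
move=> [u /= us <-].
pose c := coord (in_tuple s); exists (size s).+1.
exists (fun i => if unlift ord0 i is Some j then v + s`_j else v).
exists (fun i => if unlift ord0 i is Some j then c j u else 1 - \sum_j c j u).
split.
- by move=> i; case: unliftP => [j _|//]; apply/Cs/mem_nth.
- rewrite big_ord_recl unlift_none.
  rewrite [X in _ + X](eq_bigr (c^~ u)) ?subrK // => j _.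
  by rewrite liftK.
- rewrite big_ord_recl unlift_none.
  rewrite [X in _ = _ + X](eq_bigr (fun j => c j u *: v + c j u *: s`_j)); last first.
    by move=> j _; rewrite liftK scalerDr.
  rewrite big_split /= -scaler_suml addrA -scalerDl subrK scale1r; congr (_ + _).
  by rewrite [LHS](coord_span (X := in_tuple s)).
Qed.

End LinearAlgebra.

Section Triangular.
Context (R : fieldType) {disp : Order.disp_t} {P : finPOrderType disp}.
Variables (N : {set P}) (y : P -> {ffun P -> R^o}).
Hypothesis y_supp : forall c z, c \in N -> z \notin N -> y c z = 0.
Hypothesis y_diag : forall c, c \in N -> y c c = 1.
Hypothesis y_trig : forall c z, c \in N -> ~~ (z <= c)%O -> y c z = 0.

(** In a vanishing combination, evaluate at an element that is maximal among
    those with a nonzero coefficient: only its own term survives. *)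
Lemma triangular_free : free (map y (enum N)).
Proof.
rewrite -[map y _]/(tval (map_tuple y (enum_tuple N))); apply/freeP => k.
have yE (i : 'I_#|N|) : (map_tuple y (enum_tuple N))`_i = y (enum_val i).
  by rewrite (nth_map (enum_default i)) // -cardE.
under eq_bigr do rewrite yE; move=> k0 i; apply/eqP/negP => /negP ki.
pose below (j : 'I_#|N|) := [set w | w <= enum_val j]%O%SET.
(* A maximum of the number of elements below is maximal for the order. *)
have [j /= kj jmax] := @arg_maxnP _ i (fun j => k j != 0) (fun j => #|below j|) ki.
case/negP: kj; move/ffunP/(_ (enum_val j)): k0.
rewrite sum_ffunE (bigD1 j) //= !ffunE y_diag ?enum_valP // [_ *: _]mulr1.
rewrite big1 ?addr0 => [->|l lj] //; rewrite ffunE.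
have [->|kl] := eqVneq (k l) 0; first by rewrite scale0r.
rewrite y_trig ?enum_valP ?scaler0 //; apply/negP => jl.
have := jmax l kl; rewrite leqNgt => /negP[]; apply/proper_card/properP; split.
  by apply/fintype.subsetP => w; rewrite !inE => /le_trans; apply.
exists (enum_val l); rewrite !inE ?lexx //; apply/negP => lj'.
by move/eqP: lj; apply; apply/enum_val_inj/le_anti; rewrite lj' jl.
Qed.

(** The functions vanishing outside N are spanned by #|N| indicator functions,
    so the independent family y, which has the same size, spans them too. *)
Lemma triangular_span (u : {ffun P -> R^o}) :
  (forall z, z \notin N -> u z = 0) -> u \in <<map y (enum N)>>%VS.
Proof.
pose e c : {ffun P -> R^o} := [ffun z => (z == c)%:R].
have spanE (w : {ffun P -> R^o}) :
    (forall z, z \notin N -> w z = 0) -> w \in <<map e (enum N)>>%VS.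
  move=> w0; have -> : w = \sum_(c in N) (w c : R) *: e c.
    apply/ffunP => z; rewrite sum_ffunE; have [zN|/[dup] zN /w0->] := boolP (z \in N).
      rewrite (bigD1 z) //= !ffunE eqxx [_ *: _]mulr1 big1 ?addr0 // => c /andP[_ cz].
      by rewrite !ffunE eq_sym (negPf cz) scaler0.
    rewrite big1 // => c cN; rewrite !ffunE; case: eqP => [zc|]; last by rewrite scaler0.
    by rewrite zc cN in zN.
  by apply: rpred_sum => c cN; apply/rpredZ/memv_span/map_f; rewrite mem_enum.
move=> /spanE; suff /eqP-> : (<<map y (enum N)>> == <<map e (enum N)>>)%VS by [].
rewrite eqEdim; apply/andP; split.
  apply/span_subvP => _ /mapP[c + ->]; rewrite mem_enum => cN.
  by apply: spanE => z; apply: y_supp.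
by rewrite (eqP triangular_free) size_map (leq_trans (dim_span _)) ?size_map.
Qed.

End Triangular.

(** * The polytope *)

Section PolytopeDim.
Import classical_sets.
Local Open Scope classical_set_scope.
Context (R : realType) {disp : Order.disp_t} (H : finTBDistrLatticeType disp).
Local Notation P := (join_irreducibles H).
Local Notation Pplus := (with_infty P).
Local Notation oo := (infty : Pplus).
Local Notation b := (x0 H).
Variable eps : int.
Implicit Types (c : P).

Lemma x0_le z : (b <= z)%O.
Proof. exact: (le0x (val z)). Qed.

(** The least point of the polytope, by [qdist_potential] with y = oo. *)
Definition least_potential (z : Pplus) : int := qdist eps z oo.

(** The least function satisfying the covering inequalities that dominates
    [least_potential] everywhere and exceeds it by at least 1 at c. *)
Definition raised_potential c (z : Pplus) : int :=
  if (z <= fin c)%O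
  then Order.max (least_potential z)
                 (qdist eps z (fin c) + least_potential (fin c) + 1)
  else least_potential z.

Lemma least_potential_covers (z z' : Pplus) :
  covers z z' -> eps <= least_potential z - least_potential z'.
Proof.
move=> zz'; rewrite lerBrDr; apply: le_trans (lerD (qdist_covers _ zz') (lexx _)) _.
exact/qdist_triangle/le_inftyx/ltW/covers_lt.
Qed.

Lemma raised_potential_covers c (z z' : Pplus) :
  covers z z' -> eps <= raised_potential c z - raised_potential c z'.
Proof.
move=> zz'; have zz := ltW (covers_lt zz').
have f_cov := least_potential_covers zz'.
rewrite /raised_potential; case: ifPn => zc; case: ifPn => z'c.
- have := lerD (qdist_covers eps zz') (lexx (qdist eps z' (fin c))).
  move=> /le_trans/(_ (qdist_triangle eps zz z'c)) q_cov.
  by rewrite /Order.max; do 2 case: ifP; lia.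
- rewrite /Order.max; case: ifP; lia.
- by rewrite (le_trans zz z'c) in zc.
- by [].
Qed.

Lemma in_polytope_int (nu : Pplus -> int) :
  nu oo = 0 -> (forall z z', covers z z' -> eps <= nu z - nu z') ->
  nu (fin b) = qdist eps (fin b) oo ->
  polytope R H eps [ffun z => (nu (fin z))%:~R].
Proof.
move=> nuoo nucov nub; exists (fun z => (nu z)%:~R) => //; split.
- by rewrite nuoo.
- by move=> z z' /nucov; rewrite -rmorphB ler_int.
- by rewrite nuoo subr0 nub.
Qed.

Lemma polytope_critical nu z : in_polytope eps nu -> critical b eps z ->
  nu (fin z) = (least_potential (fin z))%:~R :> R.
Proof.
move=> [nuoo nucov nub] /eqP crit; apply/le_anti/andP; split; last first.
  by have := qdist_potential nucov (le_inftyx (fin z)); rewrite nuoo subr0.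
have := qdist_potential nucov (le_fin_bottom x0_le (fin z)).
move: nub; rewrite -crit nuoo subr0 rmorphD => ->.
by rewrite lerBrDr lerD2l.
Qed.

(** For z <= c, a saturated chain that follows an optimal one from b to z and
    then goes through c to oo weighs at most M - 1, by integrality. Hence
    q(z, c) + q(c, oo) + 1 <= q(z, oo), and the maximum is not raised at z. *)
Lemma raised_potential_critical c z :
  ~~ critical b eps c -> critical b eps z ->
  raised_potential c (fin z) = least_potential (fin z).
Proof.
rewrite /raised_potential /least_potential => c_crit /eqP z_crit.
have c_lt : qdist eps (fin b : Pplus) (fin c) + qdist eps (fin c : Pplus) oo
             < qdist eps (fin b : Pplus) oo.
  by rewrite lt_neqAle c_crit qdist_triangle ?le_inftyx ?(le_fin_bottom x0_le).
case: ifP => // zc; apply/max_idPl.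
have := qdist_triangle eps (le_fin_bottom x0_le (fin z)) zc.
by lia.
Qed.

Lemma critical_x0 : critical b eps b.
Proof. by rewrite /critical qdistxx add0r. Qed.

(** The differences of the raised potentials and the least one are triangular,
    and the polytope lies in the translate by the least potential of the
    functions vanishing at critical elements. *)
Lemma has_dim_polytope :
  has_dim (polytope R H eps) #|[set z | ~~ critical b eps z]%SET|.
Proof.
set N := [set z | _]%SET.
pose v : {ffun P -> R^o} := [ffun z => (least_potential (fin z))%:~R].
pose y c : {ffun P -> R^o} :=
  [ffun z => (raised_potential c (fin z) - least_potential (fin z))%:~R].
have y_supp c z : c \in N -> z \notin N -> y c z = 0.
  rewrite !inE negbK => cN zN.
  by rewrite ffunE raised_potential_critical // subrr.
have y_diag c : c \in N -> y c c = 1.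
  move=> cN; rewrite ffunE /raised_potential lexx qdistxx add0r.
  by rewrite max_r ?lerDl // addrAC subrr add0r.
have y_trig c z : c \in N -> ~~ (z <= c)%O -> y c z = 0.
  by move=> cN zc; rewrite ffunE /raised_potential le_fin (negPf zc) subrr.
have <- : size (map y (enum N)) = #|N| by rewrite size_map -cardE.
apply: (@has_dim_free _ _ _ v).
- exact: (@in_polytope_int least_potential (qdistxx _ _) least_potential_covers).
- move=> _ /mapP[c + ->]; rewrite mem_enum inE => cN.
  have -> : v + y c = [ffun z => (raised_potential c (fin z))%:~R].
    by apply/ffunP => z; rewrite !ffunE -rmorphD addrC subrK.
  apply: (@in_polytope_int (raised_potential c)).
  - exact: qdistxx.
  - exact: raised_potential_covers.
  - by rewrite raised_potential_critical ?critical_x0.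
- move=> _ [nu nuP <-]; apply: triangular_span => // z.
  by rewrite inE negbK => zN; rewrite !ffunE (polytope_critical nuP zN) subrr.
- exact: triangular_free.
Qed.

End PolytopeDim.

Theorem corollary4p8 (R : realType) (disp : Order.disp_t)
    (H : finTBDistrLatticeType disp) :
  has_dim (polytope R H 1) #|Pnonmax (join_irreducibles H)| /\
  has_dim (polytope R H (-1)) #|Pnonmin (join_irreducibles H)|.
Proof.
split.
  have -> : Pnonmax (join_irreducibles H) = [set z | ~~ critical (x0 H) 1 z].
    by apply/setP => z; rewrite (in_Pnonmax (@x0_le _ H)) inE.
  exact: has_dim_polytope.
have -> : Pnonmin (join_irreducibles H) = [set z | ~~ critical (x0 H) (-1) z].
  by apply/setP => z; rewrite (in_Pnonmin (@x0_le _ H)) inE.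
exact: has_dim_polytope.
Qed.
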